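(* Let $p$ be a prime and let $X$ and $Y$ be Cayley objects of $\mathbb{Z}_{p^2}$, such that $P_i$ is a Sylow $p$-subgroup of both $\mathrm{Aut}(X)$ and $\mathrm{Aut}(Y)$, for some $2\le i\le p-1$. Let $\beta\in\mathbb{Z}_{p^2}^*$ be such that $|\beta|=p-1$. Then $X$ and $Y$ are isomorphic if and only if they are isomorphic by $\alpha=\hat\beta^{\,j}\gamma_{i+1}^k$ (that is, $\alpha(X)=Y$), for some $1\le j\le p-1$ and $1\le k\le p$.
   Context: A combinatorial object is an ordered pair $X=(V,E)$, where $V$ is a set and $E\subseteq 2^V\cup 2^{2^V}\cup\cdots$. An isomorphism from $X=(V,E)$ to $Y=(V',E')$ is a bijection $\delta\colon V\to V'$ with $\delta(E)=E'$ (written $\delta(X)=Y$), and an automorphism is an isomorphism from $X$ to itself. For a group $G$, let $G_L=\{g_L:g\in G\}$, $g_L(h)=gh$. A combinatorial object $X=(G,E)$ is a Cayley object of $G$ if $G_L\le\mathrm{Aut}(X)$. Identify $\mathbb{Z}_p\times\mathbb{Z}_p$ with $\mathbb{Z}_{p^2}$ via $(a,b)\mapsto a+bp$ ($0\le a,b\le p-1$). Let $\tau(x)=x+1\pmod{p^2}$; for $0\le k\le p-1$ let $z_k$ map $(k,b)$ to $(k,b+1)$ and fix all $(a,b)$ with $a\ne k$; put $a_{m,k}=\binom mk(-1)^{m-k}$ and, for $1\le i\le p$, $\gamma_i=\prod_{k=0}^{p-1}z_k^{a_{p-i,k}}$ and $P_i=\langle\tau,\gamma_i\rangle$. For $\beta\in\mathbb{Z}_{p^2}^*$,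 $\hat\beta\colon\mathbb{Z}_{p^2}\to\mathbb{Z}_{p^2}$ is $\hat\beta(x)=\beta x$, and $|\beta|$ is the multiplicative order of $\beta$. *)

(* Defs.v *)
From HB Require Import structures.
From mathcomp Require Import all_boot all_order all_algebra all_fingroup all_solvable.
From mathcomp Require Import boolp classical_sets.

Set Implicit Arguments.
Unset Strict Implicit.
Unset Printing Implicit Defensive.

Import GroupScope GRing.Theory.

(* The iterated power sets of V, with the points of V treated as urelements. *)
Fixpoint tower (V : Type) (n : nat) : Type :=
  if n is m.+1 then set (tower V m) else V.

Fixpoint tower_map (V W : Type) (f : V -> W) (n : nat) :
    tower V n -> tower W n :=
  match n return tower V n -> tower W n with
  | 0 => f
  | m.+1 => fun A => image A (tower_map f (n := m))
  end.
Arguments tower_map {V W} f n _.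

(* A combinatorial object (V, E).  The set E, a subset of
   2^V \cup 2^(2^V) \cup ..., is given by its traces on the levels of that
   union: [hyperedges X n] is the part of E lying in the (n+1)-th iterated
   power set of V; E may be infinite.  Equality of two such sets E amounts to
   equality of all traces.  Levels of the union overlap only in sets that do
   not involve any point of V, such as the empty set: the record also allows
   those to occur in one trace and not in another, which is more general than
   a subset of the union; they are fixed by every bijection. *)
Record combObj (V : Type) := CombObj {
  hyperedges : forall n : nat, set (tower V n.+1)
}.
Arguments hyperedges {V} _ n _.

(* delta (E) = E' *)
Definition maps_onto (V W : Type) (delta : V -> W)
    (X : combObj V) (Y : combObj W) : Prop :=
  forall n, image (hyperedges X n) (tower_map delta n.+1) = hyperedges Y n.

Definition isomorphism (V W : Type) (delta : V -> W)
    (X : combObj V) (Y : combObj W) : Prop :=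
  bijective delta /\ maps_onto delta X Y.

Definition isomorphic (V W : Type) (X : combObj V) (Y : combObj W) : Prop :=
  exists delta : V -> W, isomorphism delta X Y.

Definition autObj (V : finType) (X : combObj V) : {set {perm V}} :=
  [set s : {perm V} | `[< isomorphism s X X >]].

Lemma tower_map_id (V : Type) n : tower_map (@id V) n = id.
Proof.
elim: n => [//|n IHn] /=; apply/funext => A.
by rewrite IHn image_id.
Qed.

Lemma tower_map_comp (U V W : Type) (f : V -> W) (g : U -> V) n :
  tower_map (f \o g) n = tower_map f n \o tower_map g n.
Proof.
elim: n => [//|n IHn] /=; apply/funext => A /=.
by rewrite IHn image_comp.
Qed.

Lemma autObj_group_set (V : finType) (X : combObj V) : group_set (autObj X).
Proof.
have mapsP (s : {perm V}) :
    reflect (maps_onto s X X) (s \in autObj X).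
  rewrite inE; apply: (iffP (asboolP _)) => [[]//|sX].
  by split=> //; exists (s^-1)%g; [apply: permK | apply: permKV].
apply/group_setP; split=> [|s t /mapsP sX /mapsP tX]; apply/mapsP => n.
  have -> : (1 : {perm V})%g = id :> (V -> V).
    by apply/funext => x; rewrite perm1.
  by rewrite tower_map_id image_id.
have -> : (s * t)%g = t \o s :> (V -> V).
  by apply/funext => x; rewrite permM.
by rewrite tower_map_comp -image_comp sX tX.
Qed.

Canonical autObj_group (V : finType) (X : combObj V) := Group (autObj_group_set X).

Definition left_regular (gT : finGroupType) : {set {perm gT}} :=
  [set perm (@mulgI gT g) | g : gT].

(* For gT := 'Z_n the group law of gT is addition. *)
Definition cayley_object (gT : finGroupType) (X : combObj gT) : Prop :=
  left_regular gT \subset autObj X.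

Definition zexpg (gT : finGroupType) (x : gT) (m : int) : gT :=
  match m with Posz n => x ^+ n | Negz n => x ^- n.+1 end.

Section PermutationsOfZp2.

Variable p : nat.
Hypothesis p_pr : prime p.

(* The identification (a, b) |-> a + b p. *)
Definition pair_code (u : 'Z_p * 'Z_p) : 'Z_(p ^ 2) := inZp (u.1 + u.2 * p).

Definition pair_decode (x : 'Z_(p ^ 2)) : 'Z_p * 'Z_p :=
  (inZp (x %% p), inZp (x %/ p)).

Let p_gt1 : 1 < p := prime_gt1 p_pr.
Let p2_gt1 : 1 < p ^ 2. Proof. by rewrite (ltn_exp2l 0). Qed.

Lemma pair_codeK : cancel pair_code pair_decode.
Proof.
have lt_p (a : 'Z_p) : a < p by rewrite -[p in _ < p](Zp_cast p_gt1) ltn_ord.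
have p_gt0 : 0 < p := ltnW p_gt1.
case=> a b; rewrite /pair_decode.
have -> : pair_code (a, b) = a + b * p :> nat.
  rewrite /= modn_small // [X in _ < X](Zp_cast p2_gt1).
  have le_b : b.+1 * p <= p ^ 2 by rewrite -mulnn leq_mul2r lt_p orbT.
  by apply: leq_trans le_b; rewrite mulSn ltn_add2r.
rewrite addnC modnMDl modn_small // divnMDl // divn_small // addn0.
by congr pair; apply: val_inj; rewrite /= modn_small.
Qed.

Lemma pair_decodeK : cancel pair_decode pair_code.
Proof.
have p_gt0 : 0 < p := ltnW p_gt1.
move=> x; apply: val_inj; rewrite /=.
have x_lt : x < p ^ 2 by rewrite -[X in _ < X](Zp_cast p2_gt1) ltn_ord.
rewrite !(@modn_small _ (Zp_trunc p).+2).
- by rewrite addnC -divn_eq modn_small.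
- by rewrite [X in _ < X](Zp_cast p_gt1) ltn_divLR // mulnn.
- by rewrite [X in _ < X](Zp_cast p_gt1) ltn_pmod.
Qed.

Definition tau : {perm 'Z_(p ^ 2)} := perm (@addIr _ (1%R : 'Z_(p ^ 2))).

(* (k, b) |-> (k, b + 1), all other points being fixed; z k is its transport
   to 'Z_(p ^ 2). *)
Definition zpair_fun (k : nat) (u : 'Z_p * 'Z_p) : 'Z_p * 'Z_p :=
  if u.1 == k :> nat then (u.1, (u.2 + 1)%R) else u.

Lemma zpair_fun_inj k : injective (zpair_fun k).
Proof.
move=> [a b] [c d] e; have ac : a = c.
  by move: e; rewrite /zpair_fun; case: ifP; case: ifP => _ _ /(congr1 fst).
move: e; rewrite /zpair_fun ac; case: ifP => _ // /(congr1 snd) /= bd.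
by rewrite (addIr 1%R bd).
Qed.

Lemma z_inj k : injective (pair_code \o zpair_fun k \o pair_decode).
Proof.
apply: inj_comp (can_inj pair_decodeK).
exact: inj_comp (can_inj pair_codeK) (@zpair_fun_inj k).
Qed.

Definition z (k : nat) : {perm 'Z_(p ^ 2)} := perm (@z_inj k).

(* The truncated m - k is harmless: 'C(m, k) = 0 when k > m. *)
Definition acoef (m k : nat) : int := ('C(m, k)%:R * (-1) ^+ (m - k))%R.

(* The z k commute pairwise, so the order of the product is irrelevant. *)
Definition gamma (i : nat) : {perm 'Z_(p ^ 2)} :=
  \prod_(k < p) zexpg (z k) (acoef (p - i) k).

Definition Pgroup (i : nat) : {group {perm 'Z_(p ^ 2)}} :=
  <<[set tau; gamma i]>>%G.

Definition hat (beta : {unit 'Z_(p ^ 2)}) : {perm 'Z_(p ^ 2)} :=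
  perm (mulrI (valP beta)).

End PermutationsOfZp2.

(* Main.v *)
Require Import Defs.
From HB Require Import structures.
From mathcomp Require Import all_boot all_order all_algebra all_fingroup all_solvable.
From mathcomp Require Import boolp classical_sets ring zify.

(* Put R = Z_{p^2}.  In the group ring F_p[t]/(t^p - 1) of the base group
   generated by the z_k, gamma_i is (t - 1)^(p - i), so P_i consists of the maps
   x |-> x + c + F x where F : Z_p -> pR is killed by the i-th power of the
   difference operator t - 1.  By Sylow's theorem an isomorphism from X to Y can
   be corrected by an automorphism of Y into some d normalizing P_i.  Conjugating
   tau by d gives d (x + 1) = d x + c + F (d x), whence d x = d 0 + c x + H x with
   p H = 0 and H (x + 1) - H x = F (d 0 + c x).  As i < p, the values of the
   right-hand side over Z_p sum to 0, so H is p-periodic, and it is killed by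
   (t - 1)^(i + 1).  Then c is a unit, congruent to some power of beta modulo p,
   and d lies in <hat beta> <gamma_{i+1}> P_i. *)

Set Implicit Arguments.
Unset Strict Implicit.
Unset Printing Implicit Defensive.

Import GRing.Theory.
Local Open Scope ring_scope.

Section FibreTranslations.

Variable p : nat.
Hypothesis p_pr : prime p.

Local Notation R := 'Z_(p ^ 2).
Implicit Types (F G : R -> R) (x y : R).

Let p_gt1 : (1 < p)%N := prime_gt1 p_pr.
Let p_gt0 : (0 < p)%N := prime_gt0 p_pr.
Let p2_gt1 : (1 < p ^ 2)%N. Proof. by rewrite (ltn_exp2l 0). Qed.

(** * Arithmetic modulo p^2 and the ideal pR *)

Lemma natr_Zp2_eq0 n : (n%:R == 0 :> R) = (p ^ 2 %| n)%N.
Proof. by rewrite -val_eqE /= val_Zp_nat. Qed.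

Lemma natr_pM_eq0 n : (p%:R * n%:R == 0 :> R) = (p %| n)%N.
Proof. by rewrite -natrM natr_Zp2_eq0 -mulnn dvdn_pmul2l. Qed.

Lemma pp0 : p%:R * p%:R = 0 :> R.
Proof. by apply/eqP; rewrite natr_pM_eq0. Qed.

(** Zero is written as p * p, not 0 * p, so that k has the range allowed for the exponent of [gamma]
    in the theorem. *)
Lemma p_torsionP y : p%:R * y = 0 ->
  exists2 k, (1 <= k <= p)%N & y = k%:R * p%:R.
Proof.
rewrite -[y]natr_Zp => /eqP; rewrite natr_pM_eq0 => /dvdnP[k ->].
case: k => [|k].
  by exists p; rewrite ?p_gt0 ?leqnn // pp0.
exists (k %% p).+1; first by rewrite ltn_pmod.
rewrite -natrM {1}(divn_eq k p) -addnS mulnDl natrD; apply/eqP.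
by rewrite -subr_eq0 addrK natr_Zp2_eq0 -mulnA mulnn dvdn_mull.
Qed.

Lemma Zp2_ind (P : R -> Prop) : P 0 -> (forall x, P x -> P (x + 1)) ->
  forall x, P x.
Proof.
move=> P0 PS x; rewrite -[x]natr_Zp; elim: (x : nat) => // n.
by rewrite -natr1; apply: PS.
Qed.

(** * Functions from Z_p to pR, filtered by degree *)

(* F induces a map from Z_p to pR, where R = Z_{p^2}. *)
Definition fibral F :=
  (forall x, F (x + p%:R) = F x) /\ (forall x, p%:R * F x = 0).

Lemma fibral_torsion F x y : fibral F -> p%:R * y = 0 -> F (x + y) = F x.
Proof.
move=> [Fp _] /p_torsionP[k _ ->]; elim: k => [|k IHk].
  by rewrite mul0r addr0.
by rewrite -natr1 mulrDl mul1r addrA Fp.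
Qed.

Lemma fibral0 : fibral (fun=> 0).
Proof. by split=> // x; rewrite mulr0. Qed.

Lemma fibralD F G : fibral F -> fibral G -> fibral (fun x => F x + G x).
Proof.
by move=> [Fp F0] [Gp G0]; split=> x; rewrite ?Fp ?Gp // mulrDr F0 G0 addr0.
Qed.

Lemma fibralZ (c : R) F : fibral F -> fibral (fun x => c * F x).
Proof.
by move=> [Fp F0]; split=> x; rewrite ?Fp // mulrCA F0 mulr0.
Qed.

(** The action of t - 1: conjugation by [tau] turns translation by F into translation by x |-> F (x
    - 1). *)
Definition bdiff F x := F (x - 1) - F x.

(* For i <= p, the polynomial functions of degree < i from Z_p to pR. *)
Fixpoint deg_lt i F : Prop :=
  if i is j.+1 then fibral F /\ deg_lt j (bdiff F) else F = fun=> 0.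

Lemma deg_lt_fibral i F : deg_lt i F -> fibral F.
Proof. by case: i => [->|i []//]; apply: fibral0. Qed.

Lemma deg_lt0 i : deg_lt i (fun=> 0).
Proof.
elim: i => //= i IHi; split; first exact: fibral0.
by congr deg_lt: IHi; apply/funext => x; rewrite /bdiff subr0.
Qed.

Lemma deg_ltS i F : deg_lt i F -> deg_lt i.+1 F.
Proof.
elim: i F => [F ->|i IHi F []]; first exact: deg_lt0.
by split; last exact: IHi.
Qed.

Lemma deg_ltD i F G : deg_lt i F -> deg_lt i G ->
  deg_lt i (fun x => F x + G x).
Proof.
elim: i F G => [F G -> ->|i IHi F G [fibF dF] [fibG dG]] /=.
  by apply/funext => x; rewrite addr0.
split; first exact: fibralD.
congr deg_lt: (IHi _ _ dF dG).
by apply/funext => x; rewrite /bdiff; ring.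
Qed.

Lemma deg_ltZ i (c : R) F : deg_lt i F -> deg_lt i (fun x => c * F x).
Proof.
elim: i F => [F ->|i IHi F [fibF dF]] /=.
  by apply/funext => x; rewrite mulr0.
split; first exact: fibralZ.
congr deg_lt: (IHi _ dF).
by apply/funext => x; rewrite /bdiff mulrBr.
Qed.

Lemma deg_lt_sum i n (F : 'I_n -> R -> R) : (forall l, deg_lt i (F l)) ->
  deg_lt i (fun x => \sum_(l < n) F l x).
Proof.
elim: n F => [|n IHn] F dF.
  by congr deg_lt: (deg_lt0 i); apply/funext => x; rewrite big_ord0.
have := deg_ltD (IHn _ (fun l => dF (widen_ord (leqnSn n) l))) (dF ord_max).
by congr deg_lt; apply/funext => x; rewrite big_ord_recr.
Qed.

Lemma deg_lt_shift i (c : R) F : deg_lt i F -> deg_lt i (fun x => F (x + c)).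
Proof.
elim: i F => [F ->|i IHi F [[Fp F0] dF]] //=.
split; first by split=> x //; rewrite addrAC Fp.
congr deg_lt: (IHi _ dF).
by apply/funext => x; rewrite /bdiff addrAC.
Qed.

(** With c read as a natural number, F (c x - c) - F (c x) telescopes into c values of [bdiff F], at
    c x - l for l < c; the induction hypothesis applies to each shifted copy. *)
Lemma deg_lt_dilate i (c : R) F : deg_lt i F -> deg_lt i (fun x => F (c * x)).
Proof.
elim: i F => [F ->|i IHi F dF] //=.
have [fibF bF] := dF; split.
  split=> x; last by case: fibF.
  by rewrite mulrDr fibral_torsion // mulrCA pp0 mulr0.
have dFl (l : 'I_c) := IHi _ (deg_lt_shift (- (l : nat)%:R) bF).
congr deg_lt: (deg_lt_sum dFl); apply/funext => x; rewrite /bdiff.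
have -> : c * (x - 1) = c * x - (c : nat)%:R by rewrite mulrBr mulr1 natr_Zp.
elim: (c : nat) => [|n IHn]; first by rewrite big_ord0 subr0 subrr.
by rewrite big_ord_recr /= IHn -natr1 [in RHS]opprD [in RHS]addrA; ring.
Qed.

Lemma deg_lt_weaken i j F : (i <= j)%N -> deg_lt i F -> deg_lt j F.
Proof.
move/subnK <-; elim: (j - i)%N => // n IHn /IHn.
by rewrite addSn; apply: deg_ltS.
Qed.

(** * The functions [gamma_shift i] and their differences *)

(* gamma i is x |-> x + gamma_shift i x. *)
Definition gamma_shift i x : R := p%:R * (acoef (p - i) (x %% p))%:~R.

Lemma modp_addp x : ((x + p%:R)%R %% p = x %% p)%N.
Proof.
rewrite -[x in LHS]natr_Zp -natrD val_Zp_nat //.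
by rewrite modn_dvdm ?modnDr // dvdn_mulr.
Qed.

Lemma modpB1 x : ((x - 1)%R %% p = if x %% p == 0 then p.-1 else (x %% p).-1)%N.
Proof.
have -> : (x %% p = ((x - 1)%R %% p).+1 %% p)%N.
  rewrite -[x in LHS](subrK 1) -[x - 1 in LHS]natr_Zp natr1 val_Zp_nat //.
  by rewrite modn_dvdm ?dvdn_mulr // -[in RHS]addn1 modnDml addn1.
have: ((x - 1)%R %% p < p)%N by rewrite ltn_pmod.
case: (_ %% p)%N => [|k]; first by rewrite modn_small.
rewrite leq_eqVlt => /predU1P[eq_kp | lt_kp]; last by rewrite modn_small.
by rewrite eq_kp modnn -eq_kp.
Qed.

(** Removes the truncated subtraction: m - k and m + k have the same parity if k <= m, and the
    binomial vanishes otherwise. *)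
Lemma acoefE m k : (acoef m k = 'C(m, k)%:R * (-1) ^+ (m + k))%R.
Proof.
have [le_km | lt_mk] := leqP k m; last by rewrite /acoef bin_small // !mul0r.
by rewrite /acoef -signr_odd oddB // -oddD signr_odd.
Qed.

Lemma acoefS m k : acoef m.+1 k.+1 = acoef m k - acoef m k.+1.
Proof.
rewrite !acoefE binS natrD !addSn !addnS !exprS; ring.
Qed.

Lemma gamma_shift_fibral i : fibral (gamma_shift i).
Proof.
split=> x; first by rewrite /gamma_shift modp_addp.
by rewrite mulrA pp0 mul0r.
Qed.

(** Consecutive coefficients of (t - 1)^(p - 1) differ by a coefficient of (t - 1)^p, which p
    divides, so all are congruent to the constant one. *)
Lemma gamma_shift1 x : gamma_shift 1 x = p%:R.
Proof.
rewrite /gamma_shift.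
have: (x %% p < p)%N by rewrite ltn_pmod.
elim: (x %% p)%N => [|k IHk] lt_kp.
  rewrite acoefE bin0 mul1r addn0.
  have [p2 | p_odd] := even_prime p_pr; last first.
    by rewrite -signr_odd oddB // p_odd mulr1.
  (* The constant coefficient is -1 here, but 2 * (-1) = 2 in Z_4. *)
  by rewrite p2; apply/eqP.
rewrite -[RHS]IHk ?(ltnW lt_kp) //; apply/eqP; rewrite eq_sym -subr_eq0 -mulrBr.
rewrite -rmorphB /= -acoefS subn1 prednK // acoefE rmorphM /= rmorph_nat mulrA.
have /eqP-> : p%:R * 'C(p, k.+1)%:R == 0 :> R.
  by rewrite natr_pM_eq0 prime_dvd_bin.
by rewrite mul0r.
Qed.

(** This is (t - 1) (t - 1)^(p - i - 1) = (t - 1)^(p - i), coefficientwise Pascal's rule. *)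
Lemma bdiff_gamma_shift i : (0 < i < p)%N ->
  bdiff (gamma_shift i.+1) = gamma_shift i.
Proof.
move=> /andP[i_gt0 lt_ip]; apply/funext => x.
rewrite /bdiff /gamma_shift modpB1 -mulrBr; congr (_ * _).
rewrite -rmorphB /=; congr (_%:~R).
rewrite -[(p - i)%N]prednK ?subn_gt0 // -subnS.
case: (x %% p)%N => [|k] /=; last by rewrite acoefS.
(* At residue 0 the shift wraps around to index p - 1, which exceeds p - i - 1 because i > 0. *)
rewrite [X in X - _]acoefE bin_small ?mul0r ?sub0r; last by lia.
by rewrite !acoefE !bin0 !addn0 exprS; ring.
Qed.

Lemma gamma_shift_deg i : (i < p)%N -> deg_lt i.+1 (gamma_shift i.+1).
Proof.
elim: i => [_|i IHi lt_ip]; split; try exact: gamma_shift_fibral.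
  by apply/funext => x; rewrite /bdiff !gamma_shift1 subrr.
by rewrite bdiff_gamma_shift ?lt_ip //; apply/IHi/ltnW.
Qed.

(** * Leading terms and sums over a period *)

Lemma bdiff0_const F : bdiff F = (fun=> 0) -> forall x, F x = F 0.
Proof.
move=> dF; apply: Zp2_ind => // x <-.
have /eqP := congr1 (fun f : R -> R => f (x + 1)) dF.
by rewrite /bdiff addrK subr_eq0 => /eqP.
Qed.

(** The i-th difference of [gamma_shift i.+1] is the constant p, which generates pR, so a multiple
    of it cancels the term of degree i. The multiplier k is the one found for [bdiff F] one degree
    lower. *)
Lemma deg_lt_lead i F : (i < p)%N -> deg_lt i.+1 F ->
  exists2 k, (1 <= k <= p)%N &
    deg_lt i (fun x => F x - k%:R * gamma_shift i.+1 x).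
Proof.
elim: i F => [F _ [[_ F0]] /bdiff0_const Fc|i IHi F lt_ip dF].
  have [k k_bnd F0k] := p_torsionP (F0 0).
  exists k => //; apply/funext => x.
  by rewrite gamma_shift1 Fc F0k subrr.
have [fibF bF] := dF; have [k k_bnd dk] := IHi _ (ltnW lt_ip) bF.
exists k => //; split.
  have := deg_ltD dF (deg_ltZ (- k%:R) (gamma_shift_deg lt_ip)).
  move=> /deg_lt_fibral; congr fibral.
  by apply/funext => x; rewrite mulNr.
congr deg_lt: dk; apply/funext => x.
rewrite -bdiff_gamma_shift ?lt_ip // /bdiff; ring.
Qed.

(** Splitting off leading terms leaves the sum of [gamma_shift i.+1]; as the difference of the
    p-periodic [gamma_shift i.+2], it telescopes to 0. *)
Lemma deg_lt_sum0 i F : (i < p)%N -> deg_lt i F ->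
  forall x, \sum_(l < p) F (x + l%:R) = 0.
Proof.
elim: i F => [F _ -> x|i IHi F lt_ip dF x]; first by rewrite big1.
have [k _ dk] := deg_lt_lead (ltnW lt_ip) dF.
have /= := IHi _ (ltnW lt_ip) dk x; rewrite sumrB -mulr_sumr => /eqP.
rewrite subr_eq0 => /eqP ->.
suff -> : \sum_(l < p) gamma_shift i.+1 (x + l%:R) = 0 by rewrite mulr0.
rewrite -bdiff_gamma_shift ?lt_ip //.
have telescope n : \sum_(l < n) bdiff (gamma_shift i.+2) (x + l%:R) =
    gamma_shift i.+2 (x - 1) - gamma_shift i.+2 (x - 1 + n%:R).
  elim: n => [|n IHn]; first by rewrite big_ord0 addr0 subrr.
  rewrite big_ord_recr /= IHn /bdiff -natr1.
  rewrite [x - 1 + (_ + 1)]addrACA addNr addr0.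
  by rewrite [x + _ - 1]addrAC addrA subrK.
rewrite telescope; have [-> _] := gamma_shift_fibral i.+2.
by rewrite subrr.
Qed.

(** * Permutations that translate by fibral functions *)

Definition translates (s : {perm R}) F := forall x, s x = x + F x.

Lemma translates_ext s F G : F =1 G -> translates s F -> translates s G.
Proof. by move=> eqFG sF x; rewrite sF eqFG. Qed.

Lemma translates1 : translates 1%g (fun=> 0).
Proof. by move=> x; rewrite perm1 addr0. Qed.

Lemma translatesM s t F G : fibral F -> fibral G ->
  translates s F -> translates t G -> translates (s * t)%g (fun x => F x + G x).
Proof.
move=> [_ F0] fibG sF tG x.
by rewrite permM sF tG fibral_torsion // addrA.
Qed.

Lemma translatesV s F : fibral F -> translates s F ->
  translates s^-1%g (fun x => - F x).
Proof.
move=> fibF sF x; apply: (@perm_inj _ s); rewrite permKV sF.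
by rewrite fibral_torsion ?subrK // mulrN; case: fibF => _ ->; rewrite oppr0.
Qed.

Lemma translatesX s F n : fibral F -> translates s F ->
  translates (s ^+ n)%g (fun x => n%:R * F x).
Proof.
move=> fibF sF; elim: n => [|n IHn].
  by apply: translates_ext translates1 => x; rewrite mul0r.
rewrite expgS; apply: translates_ext (translatesM fibF (fibralZ _ fibF) sF IHn).
by move=> x /=; rewrite -nat1r mulrDl mul1r.
Qed.

Lemma translates_zexpg s F (m : int) : fibral F -> translates s F ->
  translates (zexpg s m) (fun x => m%:~R * F x).
Proof.
move=> fibF sF; case: m => n; first exact: translatesX.
have := translatesV (fibralZ n.+1%:R fibF) (translatesX n.+1 fibF sF).
by apply: translates_ext => x; rewrite NegzE mulrNz mulNr.
Qed.

Lemma fibral_indic k : fibral (fun x => (x %% p == k)%N%:R * p%:R).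
Proof.
split=> x; first by rewrite modp_addp.
by rewrite mulrCA pp0 mulr0.
Qed.

Lemma translates_z k :
  translates (z p_pr k) (fun x => (x %% p == k)%N%:R * p%:R).
Proof.
move=> x; rewrite permE /= /zpair_fun /=.
rewrite (@modn_small (x %% p)%N); last first.
  by rewrite [X in (_ < X)%N]Zp_cast ?ltn_pmod.
have [_ | _] := eqVneq; last first.
  rewrite mul0r addr0; exact: (pair_decodeK p_pr x).
rewrite mul1r -[x in RHS](pair_decodeK p_pr) /pair_decode.
move: (inZp (x %% p)) (inZp (x %/ p)) => a b /=.
have codeE (u v : 'Z_p) : pair_code (u, v) = (u + v * p)%:R :> R.
  by rewrite Zp_nat.
rewrite !codeE -[b in LHS]natr_Zp natr1 val_Zp_nat // -natrD -addnA -mulSnr.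
apply/eqP; rewrite eq_sym -subr_eq0 natrD [X in _ - X]natrD opprD.
rewrite addrACA subrr add0r.
(* Reducing b + 1 modulo p changes the code by a multiple of p^2 only. *)
rewrite {1}(divn_eq b.+1 p) mulnDl natrD addrK natr_Zp2_eq0 -mulnA mulnn.
exact: dvdn_mull.
Qed.

Lemma translates_gamma i : translates (gamma p_pr i) (gamma_shift i).
Proof.
(* The number n of factors is separated from p, on which R and [z] depend, to allow induction on
   n. *)
pose S n x : R :=
  \sum_(k < n) (acoef (p - i) k)%:~R * ((x %% p == k)%N%:R * p%:R).
have trS n : fibral (S n) /\
    translates (\prod_(k < n) zexpg (z p_pr k) (acoef (p - i) k))%g (S n).
  rewrite /S; elim: n => [|n [fibS trS]].
    split; first by congr fibral: fibral0; apply/funext => x; rewrite big_ord0.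
    rewrite big_ord0; apply: translates_ext translates1 => x.
    by rewrite big_ord0.
  split.
    have := fibralD fibS (fibralZ (acoef (p - i) n)%:~R (fibral_indic n)).
    by congr fibral; apply/funext => x; rewrite big_ord_recr.
  have := translates_zexpg (acoef (p - i) n) (fibral_indic n) (translates_z n).
  move/(translatesM fibS (fibralZ _ (fibral_indic n)) trS).
  rewrite big_ord_recr; apply: translates_ext => x /=.
  by rewrite big_ord_recr.
apply: translates_ext (trS p).2 => x; rewrite /S /gamma_shift.
have xp : (x %% p < p)%N by rewrite ltn_pmod.
rewrite (bigD1 (Ordinal xp)) //= eqxx mul1r big1 ?addr0 1?mulrC // => k.
by rewrite -val_eqE /= eq_sym => /negbTE->; rewrite mul0r mulr0.
Qed.

(** * The elements of P_i *)

Lemma tauE x : tau p x = x + 1.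
Proof. by rewrite permE. Qed.

Lemma tauXE n x : (tau p ^+ n)%g x = x + n%:R.
Proof.
elim: n x => [|n IHn] x; first by rewrite perm1 addr0.
by rewrite expgSr permM IHn tauE -addrA natr1.
Qed.

Lemma tau_in i : tau p \in Pgroup p_pr i.
Proof. by rewrite mem_gen // !inE eqxx. Qed.

(** The group form of [bdiff_gamma_shift]; it yields every [gamma] of smaller index from the one
    generating P_i. *)
Lemma gamma_conj i : (0 < i < p)%N ->
  gamma p_pr i = (gamma p_pr i.+1 ^ tau p * (gamma p_pr i.+1)^-1)%g.
Proof.
move=> i_bnd; apply/permP => x; have fib := gamma_shift_fibral i.+1.
rewrite conjgE !permM tauE (translatesV fib (translates_gamma _)).
have -> : (tau p)^-1%g x = x - 1.
  by apply: (@perm_inj _ (tau p)); rewrite permKV tauE subrK.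
rewrite !translates_gamma -(bdiff_gamma_shift i_bnd) /bdiff.
have -> y : x - 1 + y + 1 = x + y by ring.
by rewrite addrA (fibral_torsion x fib (fib.2 _)).
Qed.

Lemma gamma_in i j : (0 < j)%N -> (j <= i <= p)%N ->
  gamma p_pr j \in Pgroup p_pr i.
Proof.
move=> j_gt0 /andP[/subnKC <-]; move: (i - j)%N => n.
elim: n j j_gt0 => [|n IHn] j j_gt0.
  by rewrite addn0 => _; rewrite mem_gen // !inE eqxx orbT.
rewrite addnS -addSn => le_jp; have in_j1 := IHn j.+1 isT le_jp.
rewrite gamma_conj; first by rewrite groupM ?groupV ?groupJ ?tau_in.
by rewrite j_gt0 (leq_trans _ le_jp) // ltnS leq_addr.
Qed.

(** Leading terms are stripped one degree at a time, each by a power of some [gamma] lying in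
    P_i. *)
Lemma Pgroup_translation i j s F : (j <= i <= p)%N -> deg_lt j F ->
  translates s F -> s \in Pgroup p_pr i.
Proof.
elim: j s F => [|j IHj] s F.
  move=> _ -> s1; suff -> : s = 1%g by apply: group1.
  by apply/permP => x; rewrite s1 perm1 addr0.
move=> le_ji dF sF; have [lt_ji le_ip] := andP le_ji.
have [k _ dk] := deg_lt_lead (leq_trans lt_ji le_ip) dF.
have ing : gamma p_pr j.+1 \in Pgroup p_pr i by apply: gamma_in.
rewrite -(groupMr _ (groupVr (groupX k ing))).
apply: IHj dk _; first by rewrite ltnW.
have fibg := gamma_shift_fibral j.+1.
apply: translatesM (deg_lt_fibral dF) _ sF _.
  have := fibralZ (- k%:R) fibg.
  by congr fibral; apply/funext => x; rewrite mulNr.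
by apply/translatesV/translatesX/translates_gamma => //; apply: fibralZ.
Qed.

(** Multiplying by [tau] only changes c, and multiplying by [gamma] only adds a shifted
    [gamma_shift] to F. *)
Lemma Pgroup_form i s : (0 < i <= p)%N -> s \in Pgroup p_pr i ->
  exists c F, deg_lt i F /\ forall x, s x = x + c + F x.
Proof.
case: i => // i /= lt_ip /gen_prodgP[n [t tin ->]].
elim: n t tin => [|n IHn] t tin.
  exists 0, (fun=> 0); split; first exact: (deg_lt0 i.+1).
  by move=> x; rewrite big_ord0 perm1 !addr0.
rewrite big_ord_recr /=; set u := (\prod_(_ < _) _)%g.
have [c [F [dF uE]]] : exists c F, deg_lt i.+1 F /\ forall x, u x = x + c + F x.
  by apply: IHn => l; apply: tin.
have [Fp F0] := deg_lt_fibral dF.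
have /set2P[->|->] := tin ord_max.
  by exists (c + 1), F; split=> // x; rewrite permM tauE uE; ring.
exists c, (fun x => F x + gamma_shift i.+1 (x + c)); split.
  exact: deg_ltD dF (deg_lt_shift _ (gamma_shift_deg lt_ip)).
move=> x; rewrite permM translates_gamma uE.
by rewrite (fibral_torsion _ (gamma_shift_fibral _)) // !addrA.
Qed.

(** * Powers of beta modulo p *)

Lemma hatXE (beta : {unit R}) n x : (hat beta ^+ n)%g x = val beta ^+ n * x.
Proof.
elim: n x => [|n IHn] x; first by rewrite perm1 mul1r.
by rewrite expgS permM IHn permE exprSr mulrA.
Qed.

(** The hypothesis encodes congruence modulo p. For e = x - y in pR we have e^2 = 0, so the binomial
    expansion of (y + e)^p stops at p y^(p - 1) e, which is 0. *)
Lemma exprp_eq x y : p%:R * x = p%:R * y -> x ^+ p = y ^+ p.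
Proof.
move/eqP; rewrite -subr_eq0 -mulrBr => /eqP pxy.
have [k _ xyk] := p_torsionP pxy; rewrite -[x](subrK y) addrC.
move: (x - y) pxy xyk => e pe0 ek.
have ee0 : e * e = 0 by rewrite {2}ek mulrCA mulrC [e * _]mulrC pe0 mul0r.
have binom n : (y + e) ^+ n.+1 = y ^+ n.+1 + n.+1%:R * y ^+ n * e.
  elim: n => [|n IHn]; first by rewrite !mul1r.
  rewrite exprS IHn mulrDl !mulrDr mulrCA -mulrA [e * (_ * _)]mulrCA.
  by rewrite [e * (_ * _)]mulrCA ee0 !mulr0 addr0 !exprS -[n.+2%:R]natr1; ring.
by have := binom p.-1; rewrite prednK // mulrAC pe0 mul0r addr0.
Qed.

(** By counting: the p - 1 powers of beta are distinct modulo p, hence exhaust the p - 1 nonzero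
    residues. *)
Lemma expr_unit_modp (beta : {unit R}) c : #[beta]%g = (p - 1)%N ->
  p%:R * c != 0 ->
  exists2 j, (1 <= j <= p - 1)%N & p%:R * val beta ^+ j = p%:R * c.
Proof.
move=> ord_beta pc_n0.
pose f (j : 'I_(p - 1)) := p%:R * val beta ^+ j.+1 : R.
pose g (k : 'I_(p - 1)) := p%:R * k.+1%:R : R.
have gP y : p%:R * y != 0 -> p%:R * y \in codom g.
  rewrite -[y]natr_Zp natr_pM_eq0 => ndvd.
  have m_gt0 : (0 < y %% p)%N by rewrite lt0n.
  have m_lt : ((y %% p).-1 < p - 1)%N.
    by rewrite subn1 -ltnS !prednK // ltn_pmod.
  apply/codomP; exists (Ordinal m_lt); rewrite /g /= prednK //.
  rewrite {1}(divn_eq y p) natrD mulrDr.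
  have /eqP-> : p%:R * (y %/ p * p)%:R == 0 :> R.
    by rewrite natr_pM_eq0 dvdn_mull.
  by rewrite add0r.
have f_inj : injective f.
  (* Congruent powers of beta have equal p-th powers, and p is 1 modulo the order p - 1, so the
     exponents agree modulo p - 1. *)
  move=> j l /exprp_eq; rewrite -!exprM => eq_jl.
  have: (beta ^+ (j.+1 * p) == beta ^+ (l.+1 * p))%g.
    by apply/eqP/val_inj; rewrite !FinRing.val_unitX.
  have modp n : (n * p = n %[mod p - 1])%N.
    by rewrite -{1}(subnK p_gt0) mulnDr muln1 modnMDl.
  rewrite eq_expg_mod_order ord_beta !modp -(addn1 j) -(addn1 l) eqn_modDr.
  by rewrite !modn_small // => /eqP /val_inj.
have sub_fg : {subset codom f <= codom g}.
  move=> _ /codomP[j ->]; apply: gP; apply: contraNneq pc_n0 => bj0.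
  have: p%:R * val beta ^+ j.+1 * val beta ^- j.+1 = 0.
    by rewrite bj0 mul0r.
  rewrite mulrK ?unitrX ?(valP beta) // => p0.
  by rewrite p0 mul0r.
have eq_card : #|codom f| = #|codom g|.
  apply/eqP; rewrite eqn_leq subset_leq_card; last exact/fintype.subsetP.
  by rewrite (card_codom f_inj) -(size_codom g) card_size.
have /(_ (p%:R * c)) : codom f =i codom g.
  exact/(subset_cardP eq_card)/fintype.subsetP.
rewrite gP // => /codomP[j ->].
by exists j.+1; rewrite ?ltn_ord.
Qed.

(** * The normalizer of P_i *)

(** Allows the slope of a normalizing map to be replaced by a congruent power of beta, the
    discrepancy joining the polynomial part. *)
Lemma deg_lt_linear c : p%:R * c = 0 -> deg_lt 2 (fun x => c * x).
Proof.
move=> pc0; split.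
  split=> x; last by rewrite mulrA pc0 mul0r.
  by rewrite mulrDr [c * p%:R]mulrC pc0 addr0.
have -> : bdiff (fun x => c * x) = fun=> - c.
  by apply/funext => x; rewrite /bdiff; ring.
split; first by split=> // x; rewrite mulrN pc0 oppr0.
by apply/funext => x; rewrite /bdiff subrr.
Qed.

Lemma Pgroup_normalizer_form i d : (0 < i < p)%N ->
  d \in 'N(Pgroup p_pr i)%g ->
  exists e c H, [/\ p%:R * c != 0, deg_lt i.+1 H
    & forall x, d x = e + c * x + H x].
Proof.
move=> /andP[i_gt0 lt_ip] dN.
have taud : (tau p ^ d)%g \in Pgroup p_pr i by rewrite memJ_norm ?tau_in.
have i_bnd : (0 < i <= p)%N by rewrite i_gt0 ltnW.
have [c [F [dF dE]]] := Pgroup_form i_bnd taud.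
have dS x : d (x + 1) = d x + c + F (d x).
  by rewrite -dE conjgE !permM permK tauE.
pose H x := d x - (d 0 + c * x); pose F' x := F (d 0 + c * x).
have dF' : deg_lt i F'.
  have := deg_lt_dilate c (deg_lt_shift (d 0) dF).
  by congr deg_lt; apply/funext => x; rewrite addrC.
have [_ pF0] := deg_lt_fibral dF.
have pH0 : forall x, p%:R * H x = 0.
  apply: Zp2_ind => [|x]; rewrite /H; first by rewrite mulr0 addr0 subrr mulr0.
  move=> pHx; have -> : d (x + 1) - (d 0 + c * (x + 1)) = H x + F (d x).
    by rewrite dS /H; ring.
  by rewrite mulrDr pHx pF0 addr0.
have HS x : H (x + 1) = H x + F' x.
  (* The points d x and d 0 + c x differ by H x, which p kills, so F agrees on them. *)
  rewrite /F' -(fibral_torsion (d 0 + c * x) (deg_lt_fibral dF) (pH0 x)).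
  by rewrite /H [d 0 + c * x + _]addrC subrK dS; ring.
have Hsum n x : H (x + n%:R) = H x + \sum_(l < n) F' (x + l%:R).
  elim: n => [|n IHn]; first by rewrite big_ord0 !addr0.
  by rewrite -natr1 addrA HS IHn big_ord_recr /= addrA.
have Hp x : H (x + p%:R) = H x by rewrite Hsum (deg_lt_sum0 lt_ip dF') addr0.
exists (d 0), c, H; split; last by move=> x; rewrite addrC subrK.
  (* If p c = 0, periodicity of H gives d p = d 0, against injectivity. *)
  apply/eqP => pc0; have := Hp 0; rewrite /H mulr0 add0r addr0 [c * _]mulrC.
  rewrite pc0 addr0 => /addIr /perm_inj /eqP.
  by rewrite natr_Zp2_eq0 gtnNdvd // -mulnn ltn_Pmull.
split; first by split.
have := deg_ltZ (-1) (deg_lt_shift (-1) dF').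
congr deg_lt; apply/funext => x; rewrite /bdiff.
have -> : H x = H (x - 1) + F' (x - 1) by rewrite -HS subrK.
by rewrite mulN1r opprD addrA subrr add0r.
Qed.

Lemma Pgroup_normalizer i d (beta : {unit R}) : (0 < i < p)%N ->
  #[beta]%g = (p - 1)%N -> d \in 'N(Pgroup p_pr i)%g ->
  exists j k w, [/\ (1 <= j <= p - 1)%N, (1 <= k <= p)%N, w \in Pgroup p_pr i
    & d = (w * (gamma p_pr i.+1 ^+ k * hat beta ^+ j))%g].
Proof.
move=> i_bnd ord_beta /(Pgroup_normalizer_form i_bnd)[e [c [H [pc_n0 dH dE]]]].
have [i_gt0 lt_ip] := andP i_bnd.
have [j j_bnd pbj] := expr_unit_modp ord_beta pc_n0.
pose b := val beta ^+ j.
have bU : b \is a GRing.unit by rewrite unitrX ?(valP beta).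
(* Now d x = b (x + e') + K x, so d (x - e') = b (x + b^-1 K (x - e')). Thus t = [tau] to the power
   -e' removes the constant, and k is the leading coefficient of b^-1 K (x - e'). *)
pose e' := b^-1 * e; pose K x := (c - b) * x + H x.
have dK : deg_lt i.+1 K.
  apply: deg_ltD dH; apply: (@deg_lt_weaken 2) => //.
  by apply: deg_lt_linear; rewrite mulrBr pbj subrr.
have dG := deg_ltZ b^-1 (deg_lt_shift (- e') dK).
have [k k_bnd dG'] := deg_lt_lead lt_ip dG.
pose t := (tau p ^+ (- e')%R)%g.
pose a := (gamma p_pr i.+1 ^+ k * hat beta ^+ j)%g.
(* The factor t * d * a^-1 translates by what is left after the leading term, of degree less than i,
   hence lies in P_i. *)
exists j, k, (t^-1 * (t * d * a^-1))%g; split=> //; last first.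
  by rewrite -/a -!(mulgA t) mulKg mulgKV.
rewrite groupM ?groupV ?groupX ?tau_in //.
apply: (Pgroup_translation _ dG'); first by rewrite leqnn ltnW.
move=> x; apply: (@perm_inj _ a); rewrite -permM mulgKV /a !permM hatXE.
have fibg := gamma_shift_fibral i.+1.
rewrite (translatesX k fibg (translates_gamma _)) -/b.
rewrite (fibral_torsion x fibg (proj2 (deg_lt_fibral dG') x)).
rewrite tauXE natr_Zp dE.
rewrite -(addrA x) subrK [RHS]mulrDr mulVKr // /K -/b.
have -> : e = b * e' by rewrite mulVKr.
by ring.
Qed.

End FibreTranslations.

(** * Composing isomorphisms and conjugating automorphism groups *)

Section Isomorphisms.

Variable V : finType.
Implicit Types (X Y Z : combObj V) (s t : {perm V}).

Lemma maps_ontoM X Y Z s t :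
  maps_onto s X Y -> maps_onto t Y Z -> maps_onto (s * t)%g X Z.
Proof.
move=> sXY tYZ n.
have -> : (s * t)%g = t \o s :> (V -> V) by apply/funext => x; rewrite permM.
by rewrite tower_map_comp -image_comp sXY tYZ.
Qed.

Lemma maps_ontoV X Y s : maps_onto s X Y -> maps_onto (s^-1)%g Y X.
Proof.
move=> sXY n; rewrite -sXY image_comp -tower_map_comp.
have -> : s^-1%g \o s = id by apply/funext => x /=; rewrite permK.
by rewrite tower_map_id image_id.
Qed.

Lemma autObjP X s : reflect (maps_onto s X X) (s \in autObj X).
Proof.
rewrite inE; apply: (iffP (asboolP _)) => [[]//|sX].
by split=> //; exists (s^-1)%g; [apply: permK | apply: permKV].
Qed.

Lemma autObj_conj X Y s : maps_onto s X Y -> (autObj X :^ s)%g = autObj Y.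
Proof.
move=> sXY; have sYX := maps_ontoV sXY; apply/setP => t; rewrite mem_conjg.
apply/autObjP/autObjP => tX.
  rewrite -[t](conjgKV s) conjgE; apply: maps_ontoM sYX _.
  exact: maps_ontoM tX sXY.
rewrite conjgE invgK; apply: maps_ontoM sXY _.
exact: maps_ontoM tX sYX.
Qed.

End Isomorphisms.

Theorem corollary1 (p : nat) (p_pr : prime p)
  (X Y : combObj 'Z_(p ^ 2))
  (cayX : cayley_object X) (cayY : cayley_object Y)
  (i : nat) (hi : (2 <= i <= p - 1)%N)
  (sylX : (p.-Sylow(autObj X) (Pgroup p_pr i))%g)
  (sylY : (p.-Sylow(autObj Y) (Pgroup p_pr i))%g)
  (beta : {unit 'Z_(p ^ 2)}) (hbeta : #[beta]%g = (p - 1)%N) :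
  isomorphic X Y <->
  exists j k : nat,
    [/\ (1 <= j <= p - 1)%N, (1 <= k <= p)%N
      & isomorphism ((hat beta ^+ j)%g \o (gamma p_pr i.+1 ^+ k)%g) X Y].
Proof.
split=> [[delta [delta_bij deltaXY]] | [j [k [_ _ iso]]]]; last first.
  by eexists; exact: iso.
pose s := perm (bij_inj delta_bij).
have sE : s = delta :> ('Z_(p ^ 2) -> 'Z_(p ^ 2)).
  by apply/funext => x; rewrite permE.
have sXY : maps_onto s X Y by rewrite sE.
have sylXs : (p.-Sylow(autObj Y) (Pgroup p_pr i :^ s))%g.
  by rewrite -(autObj_conj sXY) pHallJ2.
have [y /autObjP yY Py] := Sylow_trans sylXs sylY.
have dXY := maps_ontoM sXY yY.
have dN : (s * y)%g \in 'N(Pgroup p_pr i)%g.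
  by apply/normP; rewrite conjsgM -Py.
have i_bnd : (0 < i < p)%N by have := prime_gt0 p_pr; lia.
have [j [k [w [j_bnd k_bnd wP d_eq]]]] := Pgroup_normalizer i_bnd hbeta dN.
exists j, k; split=> //.
have -> : (hat beta ^+ j)%g \o (gamma p_pr i.+1 ^+ k)%g =
    (gamma p_pr i.+1 ^+ k * hat beta ^+ j)%g :> ('Z_(p ^ 2) -> 'Z_(p ^ 2)).
  by apply/funext => x; rewrite permM.
split; first exact/injF_bij/perm_inj.
(* In d = w a the factor w acts first; it lies in P_i, inside Aut(X), so removing it leaves an
   isomorphism from X to Y. *)
have -> : (gamma p_pr i.+1 ^+ k * hat beta ^+ j)%g = (w^-1 * (s * y))%g.
  by rewrite d_eq mulKg.
apply: maps_ontoM dXY; apply/maps_ontoV/autObjP.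
by apply: (fintype.subsetP (pHall_sub sylX)).
Qed.
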